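(* Let $k\ge1$ and let $\Psi_{k+1}$ be the auxiliary function of the $k$-th iteration of InSPAG with $h\equiv0$ (see context). Assume that $\phi$ is $\mu_\phi$-strongly convex and $L_\phi$-smooth with respect to the Euclidean norm, that for some $\theta>0$ and all $x\in B_2(0,R)$ one has $\max\{\|\nabla F(x)\|_2/\mu_{F/\phi},\|\nabla\phi(x)\|_2\}\le\theta$, and that $\phi$ has bounded fourth-order derivatives, equivalently Lipschitz third-order derivative: there is $0\le L_{\phi,3}<\infty$ with $\|\nabla^3\phi(x)-\nabla^3\phi(y)\|_2\le L_{\phi,3}\|x-y\|_2$ for all $x,y\in B_2(0,R)$. Let $x_{k+1}^*=\arg\min_{x\in B_2(0,R)}\Psi_{k+1}(x)$, $\mu_\Psi=(1+A_{k+1}\mu_{F/\phi})\mu_\phi$, and $$\Delta_k=\frac{\mu_\phi R_\phi^4}{2k^2(2L_\phi R+3\theta)^2(1+A_{k+1}\mu_{F/\phi})}.$$ Let $z_t$, $t\ge0$, be generated by the Restarted Hyperfast Second-Order Method described in the context. Then $$\frac{\mu_\Psi}{2}\|z_t-x_{k+1}^*\|_2^2\le\Psi_{k+1}(z_t)-\Psi_{k+1}(x_{k+1}^* )\le2\mu_\Psi R^2\cdot2^{-2t},\qquad t\ge0.$$ Moreover, the total number of steps of the basic Hyperfast second-order method to reach $\Psi_{k+1}(z_t)-\Psi_{k+1}(x_{k+1}^* )\le\Delta_k$ is bounded by $$5\left(\frac{32cL_{\phi,3}R^2}{\mu_\phi}\right)^{1/5}+\log_2\frac{(1+A_{k+1}\mu_{F/\phi})^2k^2(2L_\phi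 R+3\theta)^2}{L_\phi^2R^2}.$$
   Context: $B_2(0,R)$ is the Euclidean ball of radius $R>0$ centred at $0$ in $\mathbb{R}^d$; $R_\phi^2=2L_\phi R^2$; tensor norms are those induced by the Euclidean norm. $F$ is the smooth, strongly convex empirical risk being minimized, $\phi$ is the reference function (statistical preconditioner), and $\mu_{F/\phi}>0$ is the relative strong convexity constant of $F$ with respect to $\phi$, i.e. $F(x)-F(y)-\langle\nabla F(y),x-y\rangle\ge\mu_{F/\phi}\bigl(\phi(x)-\phi(y)-\langle\nabla\phi(y),x-y\rangle\bigr)$ for all $x,y$. **Auxiliary function.** At iteration $k$ InSPAG (with regularizer $h\equiv0$) has numbers $A_k\ge0$, $\alpha_{k+1}>0$, $A_{k+1}=A_k+\alpha_{k+1}$ (where $A_{k+1}(1+A_k\mu_{F/\phi})=M_{k+1}\alpha_{k+1}^2$ for the current $M_{k+1}>0$) and points $x_k,u_k\in B_2(0,R)$, $y_{k+1}=(\alpha_{k+1}u_k+A_kx_k)/A_{k+1}$, and has to approximately minimize over $B_2(0,R)$ $$\Psi_{k+1}(x)=\langle\alpha_{k+1}\nabla F(y_{k+1})-(1+A_k\mu_{F/\phi})\nabla\phi(u_k)-\alpha_{k+1}\mu_{F/\phi}\nabla\phi(y_{k+1}),x\rangle+(1+A_{k+1}\mu_{F/\phi})\phi(x).$$ **Basic Hyperfast second-order method.** Either of two published methods that implement an accelerated third-order method using second-order information: (i) Nesterov's (2020) inexact accelerated high-order proximal-point method with order $p=3$ and parameter $\beta=1/2$, whose auxiliary steps are carried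 out by his second-order implementation; or (ii) the Hyperfast second-order method of Kamzolov and Gasnikov (2020), based on a near-optimal tensor method. For minimizing a convex function with $L_3$-Lipschitz third-order derivative and minimizer $x_*$, started from $z_0$, the method has, after $N$ steps with output $y_N$, objective residual at most $cL_3\|x_*-z_0\|_2^4/N^5$, where $c=48$ for (i) and $c=35$ for (ii). **Restarted Hyperfast Second-Order Method.** Input $z_0\in B_2(0,R)$, the constant $c$ of the basic Hyperfast method, $\mu_\phi$. Set $R_0=2R$. For $t=0,1,\dots$: set $R_t=R_0\cdot2^{-t}$ and $N_t=\max\{\lceil(8cL_{\phi,3}R_t^2/\mu_\phi)^{1/5}\rceil,1\}$; let $z_{t+1}=y_{N_t}$ be the output of the basic Hyperfast method applied to $\Psi_{k+1}$, started from $z_t$ and run for $N_t$ steps.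
   Formalization: The upper bound on the gap at z_t is claimed only for t≥1, as it is false at t=0; at t=0 only (μ_Ψ/2)‖z_0−x*‖²≤2μ_ΨR² is kept. The basic method's guarantee is read for minimization over B_2(0,R) with outputs in that ball and N≥1. *)

(* Defs.v *)
From HB Require Import structures.
From mathcomp Require Import all_boot all_order all_algebra.
From mathcomp Require Import all_classical all_reals all_analysis.
Set Implicit Arguments.
Unset Strict Implicit.
Unset Printing Implicit Defensive.
Import Order.TTheory GRing.Theory Num.Theory.
Import numFieldNormedType.Exports.
Local Open Scope classical_set_scope.
Local Open Scope ring_scope.

(* The library norm on 'rV[R]_d is the max norm, which only serves here to
   define the topology and differentiability; every metric quantity below is
   expressed with [enorm]. *)
Definition dot (R : realType) (d : nat) (x y : 'rV[R]_d) : R :=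
  \sum_(i < d) x 0 i * y 0 i.

Definition enorm (R : realType) (d : nat) (x : 'rV[R]_d) : R :=
  Num.sqrt (dot x x).

Definition eball (R : realType) (d : nat) (rad : R) : set 'rV[R]_d :=
  [set x | enorm x <= rad].

Definition grad (R : realType) (d : nat) (f : 'rV[R]_d -> R) (x : 'rV[R]_d) :
    'rV[R]_d :=
  \row_(i < d) 'D_(delta_mx 0 i) f x.

Definition bregman (R : realType) (d : nat) (f : 'rV[R]_d -> R)
    (x y : 'rV[R]_d) : R :=
  f x - f y - dot (grad f y) (x - y).

Definition smooth (R : realType) (d : nat) (L : R) (f : 'rV[R]_d -> R) : Prop :=
  (forall x, differentiable f x) /\
  (forall x y, enorm (grad f x - grad f y) <= L * enorm (x - y)).

Definition strongly_convex (R : realType) (d : nat) (mu : R)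
    (f : 'rV[R]_d -> R) : Prop :=
  (forall x, differentiable f x) /\
  (forall x y, mu / 2 * enorm (x - y) ^+ 2 <= bregman f x y).

Definition relatively_strongly_convex (R : realType) (d : nat) (mu : R)
    (F phi : 'rV[R]_d -> R) : Prop :=
  forall x y, mu * bregman phi x y <= bregman F x y.

Definition third_derivative (R : realType) (d : nat) (f : 'rV[R]_d -> R)
    (x h1 h2 h3 : 'rV[R]_d) : R :=
  'D_h3 ('D_h2 ('D_h1 f)) x.

(* Extended-real valued, so that no junk value arises if the supremum is
   infinite. *)
Definition tensor3_norm (R : realType) (d : nat)
    (T : 'rV[R]_d -> 'rV[R]_d -> 'rV[R]_d -> R) : \bar R :=
  ereal_sup [set r | exists h1 h2 h3 : 'rV[R]_d,
    [/\ enorm h1 <= 1, enorm h2 <= 1, enorm h3 <= 1 &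
        r = (`|T h1 h2 h3|)%:E]].

Definition thrice_differentiable (R : realType) (d : nat) (D : set 'rV[R]_d)
    (f : 'rV[R]_d -> R) : Prop :=
  forall x, D x ->
    (\forall y \near x,
       differentiable f y /\ forall h, differentiable ('D_h f) y) /\
    (forall h k, differentiable ('D_k ('D_h f)) x).

Definition third_derivative_lipschitz (R : realType) (d : nat)
    (D : set 'rV[R]_d) (L3 : R) (f : 'rV[R]_d -> R) : Prop :=
  thrice_differentiable D f /\
  forall x y, D x -> D y ->
    (tensor3_norm (fun h1 h2 h3 =>
       third_derivative f x h1 h2 h3 - third_derivative f y h1 h2 h3)%R
     <= (L3 * enorm (x - y))%:E)%E.

Definition is_argmin (R : realType) (d : nat) (D : set 'rV[R]_d)
    (f : 'rV[R]_d -> R) (xs : 'rV[R]_d) : Prop :=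
  D xs /\ forall x, D x -> f xs <= f x.

(* [H f L3 z0 N] is the output y_N of a basic method for minimization over the
   ball of radius [rad], applied to [f] with third-order constant [L3], started
   from [z0] and run for [N] steps.  The published methods enter only through
   their convergence guarantee. *)
Definition basic_hyperfast (R : realType) (d : nat) (rad c : R)
    (H : ('rV[R]_d -> R) -> R -> 'rV[R]_d -> nat -> 'rV[R]_d) : Prop :=
  forall (f : 'rV[R]_d -> R) (L3 : R) (xs z0 : 'rV[R]_d) (N : nat),
    0 <= L3 ->
    @convex_function R 'rV[R]_d (@eball R d rad) f ->
    third_derivative_lipschitz (@eball R d rad) L3 f ->
    is_argmin (@eball R d rad) f xs ->
    (@eball R d rad) z0 ->
    (0 < N)%N ->
    (@eball R d rad) (H f L3 z0 N) /\
    f (H f L3 z0 N) - f xs <= c * L3 * enorm (xs - z0) ^+ 4 / N%:R ^+ 5.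

Definition restart_radius (R : realType) (rad : R) (t : nat) : R :=
  2 * rad * 2 ^- t.

Definition restart_steps (R : realType) (rad c Lphi3 muphi : R) (t : nat) :
    nat :=
  maxn `|Num.ceil
          ((8 * c * Lphi3 * restart_radius rad t ^+ 2 / muphi) `^ 5^-1)|%N
       1.

(* [LPsi3] is the third-order constant of [Psi], which the basic method needs;
   [Lphi3 / muphi] is what governs the step counts, as [LPsi3] and the strong
   convexity constant of [Psi] carry the same factor. *)
Fixpoint restarted_hyperfast (R : realType) (d : nat)
    (H : ('rV[R]_d -> R) -> R -> 'rV[R]_d -> nat -> 'rV[R]_d)
    (Psi : 'rV[R]_d -> R) (LPsi3 rad c Lphi3 muphi : R)
    (z0 : 'rV[R]_d) (t : nat) : 'rV[R]_d :=
  if t is s.+1 then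
    H Psi LPsi3
      (restarted_hyperfast H Psi LPsi3 rad c Lphi3 muphi z0 s)
      (restart_steps rad c Lphi3 muphi s)
  else z0.

(* [A] and [A'] are the accumulated weights A_k and A_(k+1). *)
Definition inspag_aux (R : realType) (d : nat) (F phi : 'rV[R]_d -> R)
    (muF alpha A A' : R) (u y x : 'rV[R]_d) : R :=
  dot (alpha *: grad F y - (1 + A * muF) *: grad phi u
       - (alpha * muF) *: grad phi y) x
  + (1 + A' * muF) * phi x.

(* The square of R_phi. *)
Definition sqr_Rphi (R : realType) (Lphi rad : R) : R := 2 * Lphi * rad ^+ 2.

Definition inspag_accuracy (R : realType)
    (muphi Lphi rad theta muF A' : R) (k : nat) : R :=
  muphi * sqr_Rphi Lphi rad ^+ 2
  / (2 * k%:R ^+ 2 * (2 * Lphi * rad + 3 * theta) ^+ 2 * (1 + A' * muF)).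

(* Main.v *)
Require Import Defs.
From HB Require Import structures.
From mathcomp Require Import all_boot all_order all_algebra.
From mathcomp Require Import all_classical all_reals all_analysis.
From mathcomp Require Import ring lra.
Import Order.TTheory GRing.Theory Num.Theory.
Import numFieldNormedType.Exports.
Local Open Scope classical_set_scope.
Local Open Scope ring_scope.

(** The auxiliary function is a linear function plus [C * phi] with
    [C = 1 + A' * muF]. Its modulus of strong convexity and the Lipschitz
    constant of its third derivative are therefore those of [phi] multiplied by
    the same [C] ([tilt_segment], [third_derivative_lipschitz_tilt]), and only
    the ratio [Lphi3 / muphi] decides how long a run of the basic method must
    be.

    Strong convexity gives quadratic growth around the constrained minimizer
    ([quadratic_growth]), so a bound on the residual is a bound on the distance
    to [xs]. Starting at distance at most [r], the guarantee
    [c * C * Lphi3 * r ^ 4 / N ^ 5] with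
    [8 * c * Lphi3 * r ^ 2 <= muphi * N ^ 5] leaves a residual of at most
    [C * muphi * r ^ 2 / 8], which by quadratic growth means distance at most
    [r / 2]. Each restart halves the radius ([restart_invariant]); the initial
    distance is at most the diameter of the ball.

    A restart from radius [r] costs at most one step more than a multiple of
    [r `^ (2 / 5)]. The multiples form a geometric series whose sum is at most
    five times its first term, and the additional single steps add up to the
    number [T] of restarts ([sum_restart_steps_le]). Let [Q] be the argument of
    the logarithm in the statement. It equals [2 * muPsi * rad ^ 2 / Delta], so
    the accuracy is reached as soon as [Q <= 4 ^ t] with [t >= 1]. For the
    first such time [T] this gives [4 ^ (T - 1) < Q] if [T >= 2], while
    [Q >= 4] covers [T <= 1]; in every case [2 ^ T <= Q], that is, [T] is at
    most the binary logarithm of [Q]. *)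

(** * Euclidean geometry of the ball *)

Section EuclideanGeometry.
Context {R : realType} {d : nat}.
Implicit Types (a x y : 'rV[R]_d) (s rad : R).

Lemma dotC x y : dot x y = dot y x.
Proof. by apply: eq_bigr => i _; rewrite mulrC. Qed.

Lemma dot_linear a : linear (dot a : 'rV[R]_d -> R^o).
Proof.
move=> s x y; rewrite /dot scaler_sumr -big_split; apply: eq_bigr => i _ /=.
by rewrite !mxE /GRing.scale /=; ring.
Qed.

HB.instance Definition _ a :=
  GRing.isLinear.Build R 'rV[R]_d R^o _ (dot a) (dot_linear a).

Lemma dotDr a x y : dot a (x + y) = dot a x + dot a y.
Proof. exact: linearD. Qed.

Lemma dotBr a x y : dot a (x - y) = dot a x - dot a y.
Proof. exact: linearB. Qed.

Lemma dotZr a s x : dot a (s *: x) = s * dot a x.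
Proof. exact: linearZ. Qed.

Lemma dotDl a x y : dot (x + y) a = dot x a + dot y a.
Proof. by rewrite dotC dotDr ![dot a _]dotC. Qed.

Lemma dotBl a x y : dot (x - y) a = dot x a - dot y a.
Proof. by rewrite dotC dotBr ![dot a _]dotC. Qed.

Lemma dotZl a s x : dot (s *: x) a = s * dot x a.
Proof. by rewrite dotC dotZr [dot a _]dotC. Qed.

Lemma enorm_ge0 x : 0 <= enorm x.
Proof. exact: sqrtr_ge0. Qed.

Lemma sqr_enorm x : enorm x ^+ 2 = dot x x.
Proof.
by rewrite sqr_sqrtr //; apply: sumr_ge0 => i _; rewrite -expr2 sqr_ge0.
Qed.

Lemma enorm_eq0 x : enorm x = 0 -> x = 0.
Proof.
move=> x0; have : dot x x = 0 by rewrite -sqr_enorm x0 expr0n.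
move=> /eqP; rewrite psumr_eq0 => [/allP x0i|i _]; last by rewrite -expr2 sqr_ge0.
apply/rowP => i; rewrite mxE; apply/eqP.
by have := x0i i (mem_index_enum i); rewrite -expr2 sqrf_eq0.
Qed.

Lemma enormZ s x : enorm (s *: x) ^+ 2 = s ^+ 2 * enorm x ^+ 2.
Proof. by rewrite !sqr_enorm dotZr dotZl; ring. Qed.

Lemma enormB x y : enorm (x - y) = enorm (y - x).
Proof. by rewrite /enorm -opprB -scaleN1r dotZr dotZl !mulN1r opprK. Qed.

(** The squared norm is its own quadratic Taylor polynomial, so the convexity
    gap along a segment is known exactly. *)
Lemma sqr_enorm_segment s x y :
  enorm ((1 - s) *: x + s *: y) ^+ 2 =
  (1 - s) * enorm x ^+ 2 + s * enorm y ^+ 2 - s * (1 - s) * enorm (x - y) ^+ 2.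
Proof.
rewrite !sqr_enorm.
rewrite !(dotBr, dotBl, dotDr, dotDl, dotZr, dotZl) [dot y x]dotC; ring.
Qed.

Lemma eballP rad x : 0 <= rad -> eball rad x <-> enorm x ^+ 2 <= rad ^+ 2.
Proof. by move=> rad0; rewrite ler_sqr// nnegrE enorm_ge0. Qed.

Lemma eball_segment rad s x y : 0 <= s <= 1 ->
  eball rad x -> eball rad y -> eball rad ((1 - s) *: x + s *: y).
Proof.
move=> /andP[s0 s1] xrad yrad; have rad0 := le_trans (enorm_ge0 x) xrad.
move: xrad yrad; rewrite !eballP // sqr_enorm_segment => xrad yrad.
have := mulr_ge0 (mulr_ge0 s0 (_ : 0 <= 1 - s)) (sqr_ge0 (enorm (x - y))).
have := ler_wpM2l s0 yrad; have := ler_wpM2l (_ : 0 <= 1 - s) xrad.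
rewrite subr_ge0; lra.
Qed.

(** The convexity gap at the midpoint is the parallelogram identity, which
    spares the triangle inequality. *)
Lemma eball_diameter rad x y :
  eball rad x -> eball rad y -> enorm (x - y) <= 2 * rad.
Proof.
move=> xrad yrad; have rad0 := le_trans (enorm_ge0 x) xrad.
rewrite -ler_sqr ?nnegrE ?enorm_ge0 ?mulr_ge0 //.
have := sqr_ge0 (enorm ((1 - 1 / 2) *: x + (1 / 2) *: y)).
rewrite sqr_enorm_segment; move: xrad yrad; rewrite !eballP //; lra.
Qed.

End EuclideanGeometry.

(** * Strong convexity *)

Section StrongConvexity.
Context {R : realType} {d : nat}.
Implicit Types (f : 'rV[R]_d -> R) (x y : 'rV[R]_d) (m mu s rad : R).

Lemma strongly_convex_segment mu f s x y : strongly_convex mu f ->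
  0 <= s <= 1 ->
  f ((1 - s) *: x + s *: y) + mu / 2 * (s * (1 - s) * enorm (x - y) ^+ 2)
    <= (1 - s) * f x + s * f y.
Proof.
move=> [_ fmu] /andP[s0 s1]; set w := (1 - s) *: x + s *: y.
have xw : x - w = s *: (x - y).
  by apply/rowP => i; rewrite /w !mxE; ring.
have yw : y - w = (- (1 - s)) *: (x - y).
  by apply/rowP => i; rewrite /w !mxE; ring.
have s1' : 0 <= 1 - s by rewrite subr_ge0.
have := ler_wpM2l s1' (fmu x w); have := ler_wpM2l s0 (fmu y w).
rewrite /bregman xw yw !enormZ !dotZr; lra.
Qed.

(** Comparing the minimizer with the points of the segment towards [x] gives
    the bound with the extra factor [1 - s]; letting [s] tend to [0] removes
    it. *)
Lemma quadratic_growth m rad f xs x :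
  (forall s, 0 <= s <= 1 ->
    f ((1 - s) *: xs + s *: x) + m / 2 * (s * (1 - s) * enorm (xs - x) ^+ 2)
      <= (1 - s) * f xs + s * f x) ->
  is_argmin (eball rad) f xs -> eball rad x ->
  m / 2 * enorm (x - xs) ^+ 2 <= f x - f xs.
Proof.
move=> fm [xsrad xsmin] xrad; rewrite enormB.
set K := m / 2 * _; set G := f x - f xs.
have G0 : 0 <= G by rewrite subr_ge0 xsmin.
have KG s : 0 < s <= 1 -> (1 - s) * K <= G.
  move=> /andP[s0 s1]; have s01 : 0 <= s <= 1 by rewrite (ltW s0).
  have := fm s s01; have := xsmin _ (eball_segment _ _ _ _ s01 xsrad xrad).
  move=> h1 h2; rewrite -(ler_pM2l s0) /G /K; lra.
(* If [G < K], this [s] makes [(1 - s) * K] the midpoint of [G] and [K]. *)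
rewrite leNgt; apply/negP => GK.
have K0 : 0 < K by exact: le_lt_trans GK.
have K2 : 0 < 2 * K by lra.
have s01 : 0 < (K - G) / (2 * K) <= 1.
  by rewrite divr_gt0 ?ler_pdivrMr //=; lra.
have := KG _ s01.
have -> : (1 - (K - G) / (2 * K)) * K = (K + G) / 2 by field; rewrite gt_eqF.
lra.
Qed.

End StrongConvexity.

(** A negative [L] cannot bound norms. The two Bregman divergences between
    distinct points add up to a positive number, which rules out a constant
    gradient and hence [L = 0]. *)
Lemma smooth_strongly_convex_gt0 (R : realType) (d : nat) (L mu : R)
    (f : 'rV[R]_d -> R) :
  (0 < d)%N -> 0 < mu -> smooth L f -> strongly_convex mu f -> 0 < L.
Proof.
move=> d0 mu0 [_ fL] [_ fmu]; pose x : 'rV[R]_d := const_mx 1.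
have e0 : 0 < enorm (x - 0).
  rewrite lt_neqAle enorm_ge0 andbT eq_sym; apply/eqP => /enorm_eq0.
  by move/rowP/(_ (Ordinal d0))/eqP; rewrite !mxE subr0 oner_eq0.
have := le_trans (enorm_ge0 _) (fL x 0); rewrite pmulr_lge0 // le_eqVlt.
case/predU1P => [L0|//]; exfalso.
have gx : grad f x - grad f 0 = 0.
  apply: enorm_eq0; apply/eqP; rewrite eq_le enorm_ge0 andbT.
  by have := fL x 0; rewrite -L0 mul0r.
have := fmu x 0; have := fmu 0 x; rewrite /bregman.
rewrite (enormB 0 x).
have -> : grad f x = grad f 0 by apply/eqP; rewrite -subr_eq0 gx.
rewrite !dotBr; have : 0 < mu / 2 * enorm (x - 0) ^+ 2.
  by rewrite mulr_gt0 ?divr_gt0 // exprn_gt0.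
lra.
Qed.

(** * Linear perturbations *)

(** [tilt a C f] is the shape of the auxiliary function: the linear part
    carries the gradients collected so far, and [C = 1 + A' * muF]. *)
Definition tilt {R : realType} {d : nat} (a : 'rV[R]_d) (C : R)
  (f : 'rV[R]_d -> R) (x : 'rV[R]_d) : R := dot a x + C * f x.

Section Tilt.
Context {R : realType} {d : nat}.
Implicit Types (f : 'rV[R]_d -> R) (a h x y : 'rV[R]_d) (C mu s b : R).

Lemma tilt_segment a C mu f s x y : strongly_convex mu f -> 0 <= C ->
  0 <= s <= 1 ->
  tilt a C f ((1 - s) *: x + s *: y)
    + C * mu / 2 * (s * (1 - s) * enorm (x - y) ^+ 2)
    <= (1 - s) * tilt a C f x + s * tilt a C f y.
Proof.
move=> fmu C0 s01; have := ler_wpM2l C0 (strongly_convex_segment _ _ s x y fmu s01).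
rewrite /tilt dotDr !dotZr; lra.
Qed.

Lemma convex_function_tilt (D : set 'rV[R]_d) a C mu f :
  strongly_convex mu f -> 0 <= mu -> 0 <= C ->
  @convex_function R 'rV[R]_d D (tilt a C f).
Proof.
move=> fmu mu0 C0 t x y _ _; rewrite convRE.
have t0 : 0 <= (t%:inum : R) by rewrite ge0.
have t1 : 0 <= 1 - (t%:inum : R) by rewrite subr_ge0 le1.
have s01 : 0 <= 1 - (t%:inum : R) <= 1 by lra.
have := tilt_segment a C mu f _ x y fmu C0 s01.
have -> : 1 - (1 - t%:inum) = t%:inum :> R by ring.
by move=> h; apply: (le_trans _ h); rewrite lerDl !mulr_ge0 ?enorm_ge0 ?invr_ge0.
Qed.

Lemma differentiable_dot a x : differentiable (dot a : 'rV[R]_d -> R) x.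
Proof.
have -> : dot a = \sum_(i < d) (a 0 i *: (fun y : 'rV[R]_d => y 0 i : R^o)).
  by apply/funext => y; rewrite fct_sumE.
by apply: differentiable_sum => i; apply/differentiableZ/differentiable_coord.
Qed.

Lemma derive_dot a h x : 'D_h (dot a : 'rV[R]_d -> R) x = dot a h.
Proof.
rewrite deriveE; last exact: differentiable_dot.
rewrite (@diff_lin _ _ _ (dot a : {linear 'rV[R]_d -> R^o})) // => y.
exact/differentiable_continuous/differentiable_dot.
Qed.

Lemma tiltE a C f : tilt a C f = dot a + C *: f.
Proof. by apply/funext. Qed.

Lemma differentiable_tilt a C f x :
  differentiable f x -> differentiable (tilt a C f) x.
Proof.
move=> fx; rewrite tiltE; apply: differentiableD; first exact: differentiable_dot.
exact: differentiableZ.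
Qed.

Lemma derive_tilt a C f h x : differentiable f x ->
  'D_h (tilt a C f) x = dot a h + C * 'D_h f x.
Proof.
move=> fx; have dfx : derivable f x h by exact: diff_derivable.
rewrite tiltE deriveD; [|exact/diff_derivable/differentiable_dot|exact: derivableZ].
by rewrite deriveZ // derive_dot.
Qed.

Lemma differentiable_affine b C f x :
  differentiable f x -> differentiable (fun y => b + C * f y) x.
Proof.
move=> fx; apply: (differentiableD (f := cst b)); first exact: differentiable_cst.
exact: differentiableZ.
Qed.

Lemma derive_affine b C f h x : differentiable f x ->
  'D_h (fun y => b + C * f y) x = C * 'D_h f x.
Proof.
move=> fx; have dfx : derivable f x h by exact: diff_derivable.
rewrite (deriveD (f := cst b) (g := C *: f));
  [|exact/diff_derivable/differentiable_cst|exact: derivableZ].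
by rewrite deriveZ // derive_cst add0r.
Qed.

End Tilt.

(** Differentiability only sees the germ of a function: the linear map that
    approximates [f] approximates any [g] equal to [f] near [x]. *)
Lemma near_eq_differentiable {R : realType} {V W : normedModType R}
    (f g : V -> W) (x : V) :
  (\forall y \near x, f y = g y) -> differentiable f x -> differentiable g x.
Proof.
move=> fg /diff_locallyP[df fx].
have gx : g \o shift x = cst (g x) + 'd f x +o_ 0 id.
  apply/eqaddoP => _/posnumP[e].
  move/eqaddoP : fx => /(_ e%:num) /(_ [gt0 of e%:num]).
  rewrite -(nbhs_singleton fg).
  have fg0 : \forall h \near 0, (f \o shift x) h = (g \o shift x) h.
    by move: fg; rewrite (near_shift 0) subr0.
  by apply: filterS2 fg0 => h /=; rewrite !fctE /= => ->.
apply/diff_locallyP.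
by rewrite (diff_unique (df := 'd f x) df gx).
Qed.

Section TiltThirdDerivative.
Context {R : realType} {d : nat}.
Implicit Types (f : 'rV[R]_d -> R) (a h x y : 'rV[R]_d) (C : R) (D : set 'rV[R]_d).

Lemma derive_tilt_fun a C f h : (forall x, differentiable f x) ->
  'D_h (tilt a C f) = fun x => dot a h + C * 'D_h f x.
Proof. by move=> df; apply/funext => x; exact: derive_tilt. Qed.

(** Second derivatives of [f] are available only near the points of the domain,
    so the identity holds locally; the summand [0] gives the right-hand side
    the affine form that [derive_affine] differentiates once more. *)
Lemma derive2_tilt_near a C f h h' x : (forall x, differentiable f x) ->
  (\forall y \near x, forall h, differentiable ('D_h f) y) ->
  \forall y \near x,
    'D_h' ('D_h (tilt a C f)) y = 0 + C * 'D_h' ('D_h f) y.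
Proof.
move=> df; apply: filterS => y dhf.
by rewrite add0r derive_tilt_fun // derive_affine.
Qed.

Lemma thrice_differentiable_tilt D a C f : (forall x, differentiable f x) ->
  thrice_differentiable D f -> thrice_differentiable D (tilt a C f).
Proof.
move=> df Df x Dx; have [d2f d3f] := Df _ Dx; split.
- apply: filterS d2f => y [_ dhf]; split; first exact: differentiable_tilt.
  by move=> h; rewrite derive_tilt_fun //; exact: differentiable_affine.
- move=> h h'; have d2 : \forall y \near x, forall h, differentiable ('D_h f) y.
    by apply: filterS d2f => y [].
  have dg : differentiable (fun y => 0 + C * 'D_h' ('D_h f) y) x.
    exact: differentiable_affine.
  apply: near_eq_differentiable dg.
  by apply: filterS (derive2_tilt_near a C f h h' x df d2) => y /esym.
Qed.

Lemma third_derivative_tilt D a C f x h1 h2 h3 :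
  (forall x, differentiable f x) -> thrice_differentiable D f -> D x ->
  third_derivative (tilt a C f) x h1 h2 h3 = C * third_derivative f x h1 h2 h3.
Proof.
move=> df Df Dx; have [d2f d3f] := Df _ Dx.
rewrite /third_derivative -(derive_affine 0); last exact: d3f.
apply: near_eq_derive; apply: derive2_tilt_near => //.
by apply: filterS d2f => y [].
Qed.

(** The tilt multiplies third derivatives, hence their Lipschitz constant, by
    [C], the factor that strong convexity gains as well: the conditioning
    [L3 / mu] that fixes the step counts is that of [f]. *)
Lemma third_derivative_lipschitz_tilt D a C L3 f :
  (forall x, differentiable f x) -> 0 <= C ->
  third_derivative_lipschitz D L3 f ->
  third_derivative_lipschitz D (C * L3) (tilt a C f).
Proof.
move=> df C0 [Df Lf]; split; first exact: thrice_differentiable_tilt.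
move=> x y Dx Dy; apply: ge_ereal_sup => _ [h1 [h2 [h3 [n1 n2 n3 ->]]]].
rewrite !(third_derivative_tilt D) // -mulrBr normrM (ger0_norm C0).
rewrite lee_fin -mulrA ler_wpM2l // -lee_fin.
by apply: le_trans (Lf _ _ Dx Dy); apply: ereal_sup_ubound; exists h1, h2, h3.
Qed.

End TiltThirdDerivative.

(** * The restarting schedule *)

Section Schedule.
Context {R : realType}.
Implicit Types (x a rad c L mu Q : R) (t T n : nat).

Lemma powR_invK n x : (0 < n)%N -> 0 <= x -> (x `^ n%:R^-1) ^+ n = x.
Proof.
move=> n0 x0; rewrite -powR_mulrn ?powR_ge0 // -powRrM mulVf ?powRr1 //.
by rewrite pnatr_eq0 -lt0n.
Qed.

Lemma natr_ceil_maxn1_ge x : x <= (maxn `|Num.ceil x|%N 1)%:R.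
Proof.
apply: le_trans (ceil_ge x) _; apply: (@le_trans _ _ (`|Num.ceil x|%N%:R)).
  by rewrite natr_absz ler_int ler_norm.
by rewrite ler_nat leq_maxl.
Qed.

Lemma natr_ceil_maxn1_le x : 0 <= x -> (maxn `|Num.ceil x|%N 1)%:R <= x + 1.
Proof.
move=> x0; have [_|_] := leqP 1 `|Num.ceil x|%N; last by rewrite lerDr.
have : 0 <= Num.ceil x by rewrite ceil_ge0; lra.
rewrite natr_absz => /ger0_norm ->.
by have := ceilB1_lt x; rewrite intrB /=; lra.
Qed.

Lemma restart_radius_ge0 rad t : 0 <= rad -> 0 <= restart_radius rad t.
Proof. by move=> rad0; rewrite /restart_radius !mulr_ge0 ?invr_ge0 ?exprn_ge0. Qed.

Lemma restart_radiusS rad t : restart_radius rad t.+1 = restart_radius rad t / 2.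
Proof. by rewrite /restart_radius exprS invfM; ring. Qed.

Lemma sqr_restart_radius rad t :
  restart_radius rad t ^+ 2 = 4 * rad ^+ 2 * 2 ^- (2 * t).
Proof. by rewrite /restart_radius !exprMn exprVn -exprM mulnC; ring. Qed.

Lemma restart_steps_gt0 rad c L mu t : (0 < restart_steps rad c L mu t)%N.
Proof. by rewrite leq_max orbT. Qed.

(** Rounding up makes the step count suffice. Clearing the division by [mu] and
    the fifth root leaves the inequality that cancels [L] in the guarantee of
    the basic method. *)
Lemma restart_steps_ge rad c L mu t :
  0 <= c -> 0 <= L -> 0 < mu ->
  8 * c * L * restart_radius rad t ^+ 2 <= mu * (restart_steps rad c L mu t)%:R ^+ 5.
Proof.
move=> c0 L0 mu0; rewrite [leRHS]mulrC -ler_pdivrMr //.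
rewrite -[leLHS](@powR_invK 5) //; last first.
  by rewrite !(sqr_ge0, invr_ge0, mulr_ge0) // ltW.
by rewrite ler_pXn2r ?nnegrE ?powR_ge0 ?ler0n // natr_ceil_maxn1_ge.
Qed.

(** Before rounding, the step counts decay by the factor [2 `^ (- 2 / 5)] per
    restart; the rounder ratio [4 / 5] dominates it because
    [1 / 4 <= (4 / 5) ^ 5], and its geometric series sums to the factor [5] of
    the bound. *)
Lemma restart_steps_le rad c L mu t :
  0 <= c -> 0 <= L -> 0 < mu ->
  (restart_steps rad c L mu t)%:R
    <= (32 * c * L * rad ^+ 2 / mu) `^ 5^-1 * (4 / 5) ^+ t + 1.
Proof.
move=> c0 L0 mu0; apply: le_trans (natr_ceil_maxn1_le _ (powR_ge0 _ _)) _.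
rewrite lerD2r; pose a := (32 * c * L * rad ^+ 2 / mu) `^ 5^-1; rewrite -/a.
have X0 : 0 <= 32 * c * L * rad ^+ 2 / mu.
  by rewrite !(sqr_ge0, invr_ge0, mulr_ge0) // ltW.
have a0 : 0 <= a * (4 / 5) ^+ t by rewrite mulr_ge0 ?powR_ge0 ?exprn_ge0.
rewrite -(@ler_pXn2r _ 5) ?nnegrE ?powR_ge0 // (@powR_invK 5) //; last first.
  by rewrite !(sqr_ge0, invr_ge0, mulr_ge0) // ltW.
rewrite sqr_restart_radius exprMn (@powR_invK 5) //.
rewrite (_ : _ / mu = 32 * c * L * rad ^+ 2 / mu * 2 ^- (2 * t)); last by ring.
rewrite ler_wpM2l // exprM -exprVn exprAC.
by rewrite lerXn2r ?nnegrE ?invr_ge0 ?exprn_ge0 //; lra.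
Qed.

Lemma geometric_sum_le a T : 0 <= a ->
  \sum_(t < T) a * (4 / 5) ^+ t <= 5 * a.
Proof.
move=> a0; have -> : \sum_(t < T) a * (4 / 5) ^+ t = 5 * a * (1 - (4 / 5) ^+ T).
  elim: T => [|T IH]; first by rewrite big_ord0 expr0; ring.
  by rewrite big_ord_recr /= IH exprS; field.
rewrite ler_piMr ?mulr_ge0 // gerBl exprn_ge0 //; lra.
Qed.

Lemma sum_restart_steps_le rad c L mu T :
  0 <= c -> 0 <= L -> 0 < mu ->
  (\sum_(t < T) restart_steps rad c L mu t)%N%:R
    <= 5 * (32 * c * L * rad ^+ 2 / mu) `^ 5^-1 + T%:R.
Proof.
move=> c0 L0 mu0; rewrite natr_sum; set a := _ `^ _.
apply: (@le_trans _ _ (\sum_(t < T) (a * (4 / 5) ^+ t + 1))).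
  by apply: ler_sum => t _; exact: restart_steps_le.
rewrite big_split /= sumr_const card_ord lerD ?geometric_sum_le //.
exact: powR_ge0.
Qed.

Lemma natr_le_log2 T Q : 2 ^+ T <= Q -> T%:R <= ln Q / ln 2.
Proof.
move=> TQ; have ln2 : 0 < ln 2 :> R by rewrite ln_gt0 // ltr1n.
rewrite ler_pdivlMr // mulr_natl -lnXn // ler_ln ?posrE ?exprn_gt0 //.
by apply: lt_le_trans TQ; rewrite exprn_gt0.
Qed.

End Schedule.

(** * Restarting the basic method *)

Section Restart.
Context {R : realType} {d : nat}.

(** With [N] steps from distance at most [r], the guarantee of the basic
    method and [8 * c * L * r ^+ 2 <= mu * N ^+ 5] give a residual of at most
    [C * mu / 2 * (r / 2) ^+ 2]; quadratic growth turns this into distance at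
    most [r / 2], ready for the next restart. *)
Lemma restart_invariant (H : ('rV[R]_d -> R) -> R -> 'rV[R]_d -> nat -> 'rV[R]_d)
    (Psi : 'rV[R]_d -> R) (xs z0 : 'rV[R]_d) (rad c C L mu : R) :
  basic_hyperfast rad c H -> 0 <= rad -> 0 <= c -> 0 < C -> 0 <= L -> 0 < mu ->
  @convex_function R 'rV[R]_d (@eball R d rad) Psi ->
  third_derivative_lipschitz (@eball R d rad) (C * L) Psi ->
  is_argmin (@eball R d rad) Psi xs ->
  (forall x, eball rad x -> C * mu / 2 * enorm (x - xs) ^+ 2 <= Psi x - Psi xs) ->
  eball rad z0 ->
  let z := restarted_hyperfast H Psi (C * L) rad c L mu z0 in
  forall t, [/\ eball rad (z t), enorm (z t - xs) <= restart_radius rad t &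
    (1 <= t)%N -> Psi (z t) - Psi xs <= C * mu / 2 * restart_radius rad t ^+ 2].
Proof.
move=> hH rad0 c0 C0 L0 mu0 Psicvx PsiL xsmin growth z0rad z.
elim=> [|t [ztrad ztr _]].
  split => //; rewrite /restart_radius expr0 invr1 mulr1.
  exact: (eball_diameter _ _ _ z0rad xsmin.1).
set r := restart_radius rad t in ztr *.
have r0 : 0 <= r by exact: restart_radius_ge0.
pose N := restart_steps rad c L mu t.
have N0 : 0 < N%:R ^+ 5 :> R by rewrite exprn_gt0 // ltr0n restart_steps_gt0.
have [zSrad zSres] := hH Psi (C * L) xs (z t) N (mulr_ge0 (ltW C0) L0)
  Psicvx PsiL xsmin ztrad (restart_steps_gt0 _ _ _ _ _).
have residual : Psi (z t.+1) - Psi xs <= C * mu / 2 * restart_radius rad t.+1 ^+ 2.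
  apply: le_trans zSres _; rewrite ler_pdivrMr // restart_radiusS -/r.
  have e4 : enorm (xs - z t) ^+ 4 <= r ^+ 4.
    by rewrite lerXn2r ?nnegrE ?enorm_ge0 // enormB.
  apply: le_trans (ler_wpM2l _ e4) _; first by rewrite !mulr_ge0 // ltW.
  have := restart_steps_ge rad c L mu t c0 L0 mu0; rewrite -/r -/N => hN.
  have Cr0 : 0 <= C / 8 * r ^+ 2 by rewrite !mulr_ge0 ?invr_ge0 // ltW.
  by have := ler_wpM2l Cr0 hN; lra.
split => //.
have := le_trans (growth _ zSrad) residual.
rewrite ler_pM2l ?divr_gt0 ?mulr_gt0 // ler_sqr ?nnegrE ?enorm_ge0 //.
exact: restart_radius_ge0.
Qed.

End Restart.

(** * Complexity of the restarted method *)

Theorem theorem3p6 (R : realType) (d : nat) (hd : (0 < d)%N)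
  (rad : R) (hrad : 0 < rad)
  (F phi : 'rV[R]_d -> R) (muF : R)
  (hFsmooth : exists LF : R, smooth LF F)
  (hFconvex : exists2 m : R, 0 < m & strongly_convex m F)
  (hmuF : 0 < muF)
  (hrel : relatively_strongly_convex muF F phi)
  (muphi Lphi theta Lphi3 : R)
  (hmuphi : 0 < muphi)
  (hphiconvex : strongly_convex muphi phi)
  (hphismooth : smooth Lphi phi)
  (htheta : 0 < theta)
  (hgrad : forall x, eball rad x ->
    Num.max (enorm (grad F x) / muF) (enorm (grad phi x)) <= theta)
  (hLphi3 : 0 <= Lphi3)
  (hphi3 : third_derivative_lipschitz (@eball R d rad) Lphi3 phi)
  (k : nat) (hk : (1 <= k)%N)
  (A alpha A' M : R) (xk uk y : 'rV[R]_d)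
  (hA : 0 <= A) (halpha : 0 < alpha) (hA' : A' = A + alpha)
  (hM : 0 < M) (hMalpha : A' * (1 + A * muF) = M * alpha ^+ 2)
  (hxk : eball rad xk) (huk : eball rad uk)
  (hy : y = A'^-1 *: (alpha *: uk + A *: xk))
  (Psi : 'rV[R]_d -> R)
  (hPsi : Psi = inspag_aux F phi muF alpha A A' uk y)
  (xs : 'rV[R]_d) (hxs : is_argmin (@eball R d rad) Psi xs)
  (c : R) (hc : c = 48 \/ c = 35)
  (H : ('rV[R]_d -> R) -> R -> 'rV[R]_d -> nat -> 'rV[R]_d)
  (hH : basic_hyperfast rad c H)
  (z0 : 'rV[R]_d) (hz0 : eball rad z0)
  (z : nat -> 'rV[R]_d)
  (hz : z = restarted_hyperfast H Psi ((1 + A' * muF) * Lphi3)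
              rad c Lphi3 muphi z0)
  (muPsi Delta : R)
  (hmuPsi : muPsi = (1 + A' * muF) * muphi)
  (hDelta : Delta = inspag_accuracy muphi Lphi rad theta muF A' k) :
  (forall t : nat,
    [/\ muPsi / 2 * enorm (z t - xs) ^+ 2 <= Psi (z t) - Psi xs,
        muPsi / 2 * enorm (z t - xs) ^+ 2
          <= 2 * muPsi * rad ^+ 2 * 2 ^- (2 * t) &
        (1 <= t)%N ->
          Psi (z t) - Psi xs <= 2 * muPsi * rad ^+ 2 * 2 ^- (2 * t)]) /\
  (exists T : nat,
    [/\ Psi (z T) - Psi xs <= Delta,
        (forall s : nat, (s < T)%N -> Delta < Psi (z s) - Psi xs) &
        (\sum_(s < T) restart_steps rad c Lphi3 muphi s)%N%:R
          <= 5 * (32 * c * Lphi3 * rad ^+ 2 / muphi) `^ 5^-1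
             + ln ((1 + A' * muF) ^+ 2 * k%:R ^+ 2
                   * (2 * Lphi * rad + 3 * theta) ^+ 2
                   / (Lphi ^+ 2 * rad ^+ 2)) / ln 2]).
Proof.
have c0 : 0 <= c by case: hc => ->.
have L0 : 0 < Lphi by exact: smooth_strongly_convex_gt0 hd hmuphi hphismooth hphiconvex.
have C1 : 1 < 1 + A' * muF.
  by rewrite ltrDl mulr_gt0 // hA' ltr_wpDl.
move: hPsi hz hmuPsi hDelta; set C := 1 + A' * muF in C1 * => hPsi hz hmuPsi hDelta.
have C0 : 0 < C by lra.
have muPsi0 : 0 < muPsi by rewrite hmuPsi mulr_gt0.
have [a PsiE] : exists a, Psi = tilt a C phi by eexists; exact: hPsi.
have dphi := hphiconvex.1.
have growth x : eball rad x ->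
    C * muphi / 2 * enorm (x - xs) ^+ 2 <= Psi x - Psi xs.
  move=> xrad; apply: quadratic_growth hxs xrad => s s01.
  by rewrite PsiE; apply: tilt_segment => //; exact: ltW.
have Psicvx : @convex_function R 'rV[R]_d (@eball R d rad) Psi.
  rewrite PsiE; apply: convex_function_tilt hphiconvex _ _; exact: ltW.
have Psi3 : third_derivative_lipschitz (@eball R d rad) (C * Lphi3) Psi.
  by rewrite PsiE; apply: third_derivative_lipschitz_tilt => //; exact: ltW.
have inv := restart_invariant H Psi xs z0 rad c C Lphi3 muphi hH (ltW hrad) c0 C0
  hLphi3 hmuphi Psicvx Psi3 hxs growth hz0.
rewrite /= -hz -hmuPsi in inv growth.
have radiusE t : muPsi / 2 * restart_radius rad t ^+ 2
    = 2 * muPsi * rad ^+ 2 * 2 ^- (2 * t).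
  by rewrite sqr_restart_radius; field.
have residual t : (1 <= t)%N ->
    Psi (z t) - Psi xs <= 2 * muPsi * rad ^+ 2 * 2 ^- (2 * t).
  by rewrite -radiusE; have [_ _] := inv t.
split=> [t|].
  have [ztrad ztr _] := inv t; split; [exact: growth| |exact: residual].
  rewrite -radiusE ler_pM2l ?divr_gt0 // ler_sqr ?nnegrE ?enorm_ge0 //.
  exact/restart_radius_ge0/ltW.
set Q := C ^+ 2 * _ * _ / _.
have k1 : 1 <= k%:R :> R by rewrite ler1n.
have S0 : 0 < 2 * Lphi * rad + 3 * theta.
  by rewrite addr_gt0 ?mulr_gt0.
(* [Q] compares the initial residual bound with the target accuracy. *)
have QDelta : 2 * muPsi * rad ^+ 2 = Q * Delta.
  rewrite hDelta hmuPsi /inspag_accuracy /sqr_Rphi -/C /Q; field.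
  by rewrite !gt_eqF //; lra.
have Delta0 : 0 < Delta.
  rewrite hDelta /inspag_accuracy /sqr_Rphi -/C.
  by rewrite !(exprn_gt0, invr_gt0, mulr_gt0) ?ltr0n.
have Q4 : 4 <= Q.
  rewrite /Q ler_pdivlMr ?mulr_gt0 ?exprn_gt0 // -exprMn -exprMn.
  have -> : 4 * (Lphi * rad) ^+ 2 = (2 * (Lphi * rad)) ^+ 2 by ring.
  rewrite -exprMn lerXn2r ?nnegrE ?mulr_ge0 ?(ltW L0) ?(ltW S0) ?(ltW C0) ?(ltW hrad) //.
  have Lr : 0 < Lphi * rad by rewrite mulr_gt0.
  have Ck : 1 <= C * k%:R.
    by apply: le_trans k1 _; rewrite ler_peMl ?ler0n // ltW.
  have := ler_wpM2r (ltW S0) Ck; lra.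
have small t : (1 <= t)%N -> Q <= 2 ^+ (2 * t) -> Psi (z t) - Psi xs <= Delta.
  move=> t1 Qt; apply: le_trans (residual t t1) _.
  rewrite QDelta mulrAC; apply: ler_piMl; first exact: ltW.
  by rewrite ler_pdivrMr ?exprn_gt0 // mul1r.
have exT : exists T, Psi (z T) - Psi xs <= Delta.
  exists (Num.bound Q).+1; apply: small => //.
  by apply/ltW/upper_nthrootP/(leq_trans (leqnSn _)); rewrite leq_pmull.
case: (ex_minnP exT) => T ltT minT; exists T; split => // [s sT|].
  by rewrite ltNge; apply/negP => /minT; rewrite leqNgt sT.
apply: le_trans (sum_restart_steps_le rad c Lphi3 muphi T c0 hLphi3 hmuphi) _.
rewrite lerD2l natr_le_log2 //.
(* One restart before the last the accuracy is not yet reached, but the residual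
   bound is known there only if that is not the start, so [T <= 1] is apart. *)
case: T ltT minT => [|[|T]] ltT minT; [by lra|by rewrite expr1; lra|].
apply: (@le_trans _ _ (2 ^+ (2 * T.+1))).
  by rewrite ler_weXn2l ?ler1n // mul2n -addnn addnS ltnS leq_addr.
rewrite leNgt; apply/negP => QT.
by have := minT _ (small T.+1 isT (ltW QT)); rewrite ltnn.
Qed.
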